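(* The dihedral group $D_{14}$ of order $14$ is a filled group.
   Context: For $n>1$, $D_{2n}=\langle x,y \mid x^n=y^2=1,\ xy=yx^{-1}\rangle$ is the dihedral group of order $2n$. For subsets $S,V$ of a group $G$, $SV=\{sv : s\in S, v\in V\}$. A non-empty subset $S$ of a finite group $G$ is product-free if $S\cap SS=\varnothing$. A product-free set $S$ is locally maximal if whenever $T$ is a product-free subset of $G$ with $S\subseteq T$, then $S=T$. $G^*$ denotes the set of non-identity elements of $G$. A subset $S$ of $G$ fills $G$ if $G^*\subseteq S\cup SS$. $G$ is a filled group if every locally maximal product-free set in $G$ fills $G$. *)

(* Defs.v *)
From mathcomp Require Import all_boot all_fingroup all_solvable.

Set Implicit Arguments.
Unset Strict Implicit.
Unset Printing Implicit Defensive.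

Local Open Scope group_scope.

Section Filled.

Variable gT : finGroupType.
Implicit Types (G : {group gT}) (S T : {set gT}).

Definition product_free G S : bool :=
  [&& S \subset G, S != set0 & S :&: (S * S) == set0].

Definition locally_maximal G S : Prop :=
  product_free G S /\
  forall T, product_free G T -> S \subset T -> S = T.

(* G^# is the set of non-identity elements of G. *)
Definition fills G S : bool := G^# \subset S :|: (S * S).

Definition filled_group G : Prop :=
  forall S, locally_maximal G S -> fills G S.

End Filled.

(* Main.v *)
Require Import Defs.
From mathcomp Require Import all_boot all_fingroup all_solvable.
From mathcomp Require Import zify.

(** The rotations and the reflections of a set S in D_14 are described by the
sets A and B of exponents i modulo 7 such that x^i, respectively x^i y, lies in
S. If a non-identity g lies neither in S nor in SS, then maximality forces
g^2, or gs or sg for some s in S, into S. When g is a reflection, g^2 = 1 is not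
in S and the other cases put g in SS. Hence B together with B + A and B - A
covers Z/7, and a rotation x^c outside S and SS satisfies 2c in A or c in A - A; that this is
incompatible with product-freeness is a finite check over the pairs (A, B). *)

Set Implicit Arguments.
Unset Strict Implicit.
Unset Printing Implicit Defensive.

Local Open Scope group_scope.

Lemma product_free_notin (gT : finGroupType) (G : {group gT}) (S : {set gT}) u v :
  product_free G S -> u \in S -> v \in S -> u * v \notin S.
Proof.
case/and3P=> _ _ /eqP S0 uS vS; apply/negP=> uvS.
by have := in_set0 (u * v); rewrite -S0 inE uvS mem_mulg.
Qed.

Lemma product_free1 (gT : finGroupType) (G : {group gT}) (S : {set gT}) :
  product_free G S -> 1 \notin S.
Proof.
by move=> pfS; apply/negP=> S1; have := product_free_notin pfS S1 S1; rewrite mulg1 S1.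
Qed.

(** If [g |: S] failed to be product-free through a product equal to [g], then [g = 1], [1 \in S] or
    [g \in S * S], all excluded; a product in [S] must have [g] as a factor. Only the stated cases
    remain. *)
Lemma locally_maximal_obstruction (gT : finGroupType) (G : {group gT}) (S : {set gT}) g :
    locally_maximal G S -> g \in G -> g != 1 -> g \notin S :|: S * S ->
  g * g \in S \/ exists2 s, s \in S & (g * s \in S) || (s * g \in S).
Proof.
move=> [pfS maxS] gG g1; rewrite inE negb_or => /andP[gS gSS].
have S1 := product_free1 pfS.
have [ggS|ggS] := boolP (g * g \in S); first by left.
have [/existsP[s /andP[]]|/existsPn nS] :=
  boolP [exists s, (s \in S) && ((g * s \in S) || (s * g \in S))].
  by right; exists s.
suff pfT : product_free G (g |: S).
  by case/negP: gS; rewrite (maxS _ pfT (subsetUr _ _)) setU11.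
have [SG _ _] := and3P pfS; apply/and3P; split.
- by rewrite subUset sub1set gG.
- by apply/set0Pn; exists g; rewrite setU11.
apply/set0Pn=> -[w /setIP[wT /mulsgP[u v]]].
move=> /setU1P[->|uS] /setU1P[->|vS] ew; move: wT; rewrite {}ew in_setU1.
- by rewrite (negPf ggS) orbF -{3}[g]mulg1 (inj_eq (mulgI g)) (negPf g1).
- case/orP=> [|gvS]; last by have := nS v; rewrite vS gvS.
  by rewrite -{2}[g]mulg1 (inj_eq (mulgI g)) => /eqP v1; rewrite -v1 vS in S1.
- case/orP=> [|ugS]; last by have := nS u; rewrite uS ugS orbT.
  by rewrite -{2}[g]mul1g (inj_eq (mulIg g)) => /eqP u1; rewrite -u1 uS in S1.
case/orP=> [/eqP e|]; first by rewrite -e mem_mulg in gSS.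
by rewrite (negPf (product_free_notin pfS uS vS)).
Qed.

Fixpoint bitseqs n : seq bitseq :=
  if n is m.+1 then map (cons true) (bitseqs m) ++ map (cons false) (bitseqs m)
  else [:: [::]].

Lemma mem_bitseqs n (s : bitseq) : size s = n -> s \in bitseqs n.
Proof.
elim: n s => [|n IHn] [|b s] //= [/IHn sn].
by rewrite mem_cat; case: b; rewrite (map_f (cons _) sn) ?orbT.
Qed.

Definition residues := iota 0 7.

Definition sum_free7 (a : nat -> bool) :=
  all (fun i => all (fun j => a i && a j ==> ~~ a (i + j)) residues) residues.

(** Products of a rotation with a reflection, in either order, and of two reflections all lead to
    this one condition, that A misses B - B. *)
Definition disjoint_differences7 (a b : nat -> bool) :=
  all (fun i => all (fun j => a i && b j ==> ~~ b (i + j)) residues) residues.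

(* Modulo 7, the number [6 * i] stands for [- i]. *)
Definition translates_cover7 (a b : nat -> bool) :=
  all (fun d => b d || has (fun i => a i && (b (d + i) || b (d + 6 * i))) residues)
      residues.

(** The last two clauses put x^c in SS: as x^i x^(c - i), or as x^(c + j) y times x^j y. *)
Definition sum_or_difference7 (a b : nat -> bool) c :=
  [|| a c, has (fun i => a i && a (c + 6 * i)) residues
    | has (fun j => b j && b (c + j)) residues].

(** Obstructions coming from a reflection in S are left out: they already put x^c in SS. *)
Definition obstructed7 (a : nat -> bool) c :=
  a (c + c) || has (fun i => a i && a (c + i)) residues.

(** Reducing the index keeps sums such as [d + 6 * i] within seven stored bits, away from the
    default [false]. *)
Definition periodize7 (s : bitseq) i := nth false s (i %% 7).

Lemma sum_or_difference7_check :
  all (fun s => let a := periodize7 s in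
    sum_free7 a ==> all (fun t => let b := periodize7 t in
      disjoint_differences7 a b ==> translates_cover7 a b ==>
      all (fun c => obstructed7 a c ==> sum_or_difference7 a b c) (iota 1 6))
      (bitseqs 7)) (bitseqs 7).
(* Lazy evaluation short-circuits [==>], so only sum-free A's reach the second loop. *)
Proof. by lazy. Qed.

Lemma periodize7_mkseq (a : nat -> bool) :
  (forall i, a (i %% 7) = a i) -> periodize7 (mkseq a 7) =1 a.
Proof. by move=> aP i; rewrite /periodize7 nth_mkseq ?ltn_pmod. Qed.

Lemma sum_or_difference7_exists (a b : nat -> bool) :
    (forall i, a (i %% 7) = a i) -> (forall i, b (i %% 7) = b i) ->
    (forall i j, a i -> a j -> ~~ a (i + j)%N) ->
    (forall i j, a i -> b j -> ~~ b (i + j)%N) ->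
    (forall d, b d \/ exists2 i, a i & b (d + i)%N || b (d + 6 * i)%N) ->
  forall c, 0 < c < 7 -> a (c + c)%N \/ (exists2 i, a i & a (c + i)%N) ->
  [\/ a c, exists2 i, a i & a (c + 6 * i)%N | exists2 j, b j & b (c + j)%N].
Proof.
move=> aP bP sf dd cov c c7 obs.
have ea := periodize7_mkseq aP; have eb := periodize7_mkseq bP.
have res i : i %% 7 \in residues by rewrite mem_iota ltn_pmod.
have sfA : sum_free7 (periodize7 (mkseq a 7)).
  apply/allP=> i _; apply/allP=> j _; rewrite !ea.
  by apply/implyP=> /andP[]; apply: sf.
have ddAB : disjoint_differences7 (periodize7 (mkseq a 7)) (periodize7 (mkseq b 7)).
  apply/allP=> i _; apply/allP=> j _; rewrite !ea !eb.
  by apply/implyP=> /andP[]; apply: dd.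
have covAB : translates_cover7 (periodize7 (mkseq a 7)) (periodize7 (mkseq b 7)).
  apply/allP=> d _; rewrite eb; case: (cov d) => [-> //|[i ai bi]].
  apply/orP; right; apply/hasP; exists (i %% 7) => //.
  rewrite ea !eb aP ai -bP -[b (d + 6 * _)%N]bP.
  by rewrite -(modnDmr d (6 * _)) modnMmr !modnDmr !bP.
have obsA : obstructed7 (periodize7 (mkseq a 7)) c.
  rewrite /obstructed7 ea; case: obs => [-> //|[i ai aci]].
  apply/orP; right; apply/hasP; exists (i %% 7) => //.
  by rewrite !ea aP ai -aP modnDmr aP.
have /allP/(_ _ (mem_bitseqs (size_mkseq a 7)))/implyP/(_ sfA) := sum_or_difference7_check.
move/allP/(_ _ (mem_bitseqs (size_mkseq b 7)))/implyP/(_ ddAB)/implyP/(_ covAB).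
move/allP/(_ c); rewrite mem_iota => /(_ c7)/implyP/(_ obsA).
rewrite /sum_or_difference7 ea; case/or3P=> [|/hasP[i _]|/hasP[j _]].
- by constructor 1.
- by rewrite !ea => /andP[]; constructor 2; exists i.
- by rewrite !eb => /andP[]; constructor 3; exists j.
Qed.

(** Since [y] normalizes [<[x]>], the join is a product of the two cycles, and only the parity of
    the exponent of [y] matters. *)
Lemma join_cycle_involution (gT : finGroupType) (x y g : gT) :
    y ^+ 2 = 1 -> x ^ y = x^-1 -> g \in <[x]> <*> <[y]> ->
  exists i, g = x ^+ i \/ g = x ^+ i * y.
Proof.
move=> y2 xy; rewrite norm_joinEr; last first.
  by rewrite cycle_subG; apply/normP; rewrite -cycleJ xy cycleV.
case/mulsgP=> _ _ /cycleP[i ->] /cycleP[j ->] ->; exists i.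
rewrite -(odd_double_half j) expgD -muln2 mulnC expgM y2 expg1n mulg1.
by case: odd; [right | left; rewrite mulg1].
Qed.

(* In MathComp, 'D_m is indexed by its order: 'D_14 has 14 elements. *)
Theorem theorem4p5 : filled_group 'D_14.
Proof.
have /existsP[[x y] /= /eqP[defG x7 y2 xy]] :
    'D_14 \homg Grp (x : y : x ^+ 7, y ^+ 2, x ^ y = x^-1).
  exact/isoGrp_hom/(@Grp_dihedral 7).
move=> S maxS; have [pfS _] := maxS.
have [SG _ _] := and3P pfS; have S1 := product_free1 pfS.
(* Otherwise [x] would generate the whole group and have order 14, against x^7 = 1. *)
have yx' : y \notin <[x]>.
  apply/negP=> yx; have := @card_dihedral 7 isT.
  rewrite -defG (joing_idPl _) ?cycle_subG // => /= ox.
  by have := order_dvdn x 7; rewrite x7 eqxx orderE ox.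
have eX i j : i = j %[mod 7] -> x ^+ i = x ^+ j.
  by move=> eij; rewrite -(expg_mod i x7) eij expg_mod.
have yX i : y * x ^+ i = x ^+ (6 * i) * y.
  have yV : y^-1 = y by apply/eqP; rewrite eq_invg_mul -y2.
  rewrite conjgCV yV conjXg xy expgM; congr (_ ^+ _ * _).
  by apply/eqP; rewrite eq_invg_mul -expgS x7.
have mXX i j : x ^+ i * x ^+ j = x ^+ (i + j) by rewrite expgD.
have mXY i j : x ^+ i * (x ^+ j * y) = x ^+ (i + j) * y by rewrite mulgA mXX.
have mYX i j : x ^+ i * y * x ^+ j = x ^+ (i + 6 * j) * y.
  by rewrite -mulgA yX mXY.
have mYY i j : x ^+ i * y * (x ^+ j * y) = x ^+ (i + 6 * j).
  by rewrite mulgA mYX -mulgA -(expgS y 1) y2 mulg1.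
have XnY i j : x ^+ i <> x ^+ j * y.
  move=> e; case/negP: yx'; rewrite -(mulKg (x ^+ j) y) -e.
  by rewrite groupM ?groupV ?mem_cycle.
have decG g : g \in 'D_14 -> exists i, g = x ^+ i \/ g = x ^+ i * y.
  by rewrite -defG; apply: join_cycle_involution.
have decS s sS := decG s (subsetP SG s sS).
(* ['D_14] is the full set of its own type. *)
have YG i : x ^+ i * y \in 'D_14 by rewrite inE.
pose a i := x ^+ i \in S; pose b i := x ^+ i * y \in S.
have aE i j : i = j %[mod 7] -> a i = a j by move=> e; rewrite /a (eX _ _ e).
have bE i j : i = j %[mod 7] -> b i = b j by move=> e; rewrite /b (eX _ _ e).
have cover d : b d \/ exists2 i, a i & b (d + i)%N || b (d + 6 * i)%N.
  have [|gnS] := boolP (x ^+ d * y \in S :|: S * S).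
    case/setUP=> [|/mulsgP[u v uS vS]]; first by left.
    have [i [eu|eu]] := decS u uS; have [j [ev|ev]] := decS v vS; move: uS vS;
      rewrite {}eu {}ev ?mXX ?mXY ?mYX ?mYY => uS vS.
    - by move/esym/XnY.
    - move/mulIg=> e; right; exists i => //; apply/orP; right.
      rewrite /b expgD e -expgD (eX _ j) //; clear; lia.
    - move/mulIg=> e; right; exists j => //; apply/orP; left.
      rewrite /b expgD e -expgD (eX _ i) //; clear; lia.
    - by move/esym/XnY.
  have g1 : x ^+ d * y != 1 by apply/eqP=> /esym/(XnY 0).
  have [|[s sS gsS]] := locally_maximal_obstruction maxS (YG d) g1 gnS.
    by rewrite mYY (eX _ 0) ?(negPf S1) //; clear; lia.
  right; have [i [es|es]] := decS s sS; move: sS gsS;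
    rewrite {}es ?mXX ?mXY ?mYX ?mYY => sS /orP[] tS.
  - by exists i => //; apply/orP; right.
  - by exists i => //; apply/orP; left; rewrite /b addnC.
  (* When [s] is a reflection, [g * s] or [s * g] is a rotation in S; its exponent, d - i or i - d,
     is the witness, translating d to i. *)
  - exists (d + 6 * i)%N => //; apply/orP; right; rewrite (bE _ i) //; clear; lia.
  - exists (i + 6 * d)%N => //; apply/orP; left; rewrite (bE _ i) //; clear; lia.
apply/subsetP=> g /setD1P[g1 gG]; have [c [ec|ec]] := decG g gG; last first.
  (* A reflection outside S is the product of x^(c + i) y and x^i, or of x^i and x^(c - i) y. *)
  rewrite ec inE -/(b c); case: (cover c) => [->//|[i ai /orP[]] bi]; apply/orP; right.
    by rewrite (eX _ (c + i + 6 * i)%N) -1?mYX ?mem_mulg //; clear; lia.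
  by rewrite (eX _ (i + (c + 6 * i))%N) -1?mXY ?mem_mulg //; clear; lia.
have {}ec : g = x ^+ (c %% 7) by rewrite expg_mod.
have c7 : 0 < c %% 7 < 7.
  by rewrite ltn_pmod // andbT lt0n; apply: contraNneq g1 => c0; rewrite ec c0.
move: (c %% 7) c7 ec => {}c c7 ec.
apply: contraT => gnS; have := gnS; rewrite inE negb_or => /andP[gS gSS].
have mem_SS u v : u \in S -> v \in S -> g <> u * v.
  by move=> uS vS e; case/negP: gSS; rewrite e mem_mulg.
have obs : a (c + c)%N \/ exists2 i, a i & a (c + i)%N.
  have [|[s sS gsS]] := locally_maximal_obstruction maxS gG g1 gnS.
    by rewrite ec mXX; left.
  have [i [es|es]] := decS s sS; move: sS gsS;
    rewrite {}es ec ?mXX ?mXY ?mYX ?mYY => sS /orP[] tS.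
  - by right; exists i.
  - by right; exists i; rewrite // addnC.
  (* As [s] is an involution, t = g s gives g = t s, and t = s g gives g = s t. *)
  - by case: (mem_SS _ _ tS sS); rewrite mYY ec; apply: eX; clear; lia.
  - by case: (mem_SS _ _ sS tS); rewrite mYY ec; apply: eX; clear; lia.
have [||i j ai aj|i j ai bj|ac|[i ai aci]|[j bj bcj]] :=
  @sum_or_difference7_exists a b _ _ _ _ cover c c7 obs.
- by move=> i; rewrite /a expg_mod.
- by move=> i; rewrite /b expg_mod.
- by rewrite /a -mXX (product_free_notin pfS).
- by rewrite /b -mXY (product_free_notin pfS).
- by rewrite ec [_ \in _]ac in gS.
- by case: (mem_SS _ _ ai aci); rewrite mXX ec; apply: eX; clear; lia.
- by case: (mem_SS _ _ bcj bj); rewrite mYY ec; apply: eX; clear; lia.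
Qed.
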